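(* Let $G=(V,w)$ be a finite metric space and let $v_0\in V$. Then there exists a star metric $S$ with a center $c$ and leaf set $V$, with edge weights $w_u=w(c,u)$ for $u\in V$, such that: (1) $w(S)=\sum_{u\in V} w_u = w(T_G(V))=\mathrm{MST}(G)$; (2) for every subset $V'\subseteq V$ with $v_0\in V'$, $w(T_G(V'))\ \ge\ w_S(V') := \sum_{u\in V'} w_u$.
   Context: A star metric $S$ with center $c$ and leaf set $V$ is the shortest-path metric of a star graph whose center is $c$ and whose leaves are the elements of $V$; $w(S)$ denotes the sum of the weights of the edges of $S$, and for $V'\subseteq V$, $w_S(V')=\sum_{u\in V'} w(c,u)$. For a metric space $G=(V,w)$ and $V'\subseteq V$, $T_G(V')$ denotes a minimum-weight Steiner tree of $V'$ in $G$ (a minimum total-weight connected subgraph of the complete weighted graph on $V$ with edge weights $w$ that contains all of $V'$), and $w(T_G(V'))$ is its total edge weight. $\mathrm{MST}(G)$ is the weight of a minimum spanning tree of the complete weighted graph on $V$ with weights $w$. *)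

(* Defs.v *)
From mathcomp Require Import all_boot all_order all_algebra.
Set Implicit Arguments.
Unset Strict Implicit.
Unset Printing Implicit Defensive.
Import Order.TTheory GRing.Theory Num.Theory.
Local Open Scope ring_scope.

Definition is_metric (R : realFieldType) (T : Type) (w : T -> T -> R) : Prop :=
  [/\ forall x y, 0 <= w x y,
      forall x y, w x y = 0 <-> x = y,
      forall x y, w x y = w y x
    & forall x y z, w x z <= w x y + w y z].

(* A pair (vertex set, edge set), meaningful when [subgraph] holds: edges are
   then unordered pairs of distinct vertices. *)
Definition graph (V : finType) : Type := ({set V} * {set {set V}})%type.

Definition subgraph (V : finType) (H : graph V) : bool :=
  [forall e in H.2, (#|e| == 2)%N && (e \subset H.1)].

Definition adj (V : finType) (E : {set {set V}}) : rel V :=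
  [rel x y | [set x; y] \in E].

Definition connected (V : finType) (H : graph V) : bool :=
  [forall x in H.1, forall y in H.1, connect (adj H.2) x y].

(* Bounding the length by #|V| is harmless, as [ucycleb] forces the entries of
   the cycle to be distinct; [:: x; y] passes [ucycleb] as soon as {x, y} is an
   edge, whence the exemption for lengths up to 2. *)
Definition acyclic (V : finType) (E : {set {set V}}) : bool :=
  [forall n : 'I_(#|V|.+1), forall c : n.-tuple V,
     ucycleb (adj E) c ==> (n <= 2)%N].

(* The double sum counts w(x,y) and w(y,x) for e = {x, y}, and w(x,x) = 0;
   see [edge_weight2]. *)
Definition edge_weight (R : realFieldType) (V : finType) (w : V -> V -> R)
    (e : {set V}) : R :=
  (\sum_(x in e) \sum_(y in e) w x y) / 2.

Definition weight (R : realFieldType) (V : finType) (w : V -> V -> R)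
    (H : graph V) : R :=
  \sum_(e in H.2) edge_weight w e.

(* The default (set0, set0) is returned only if no graph satisfies P; see
   [min_graphP], [steiner_subgraph_ex] and [spanning_tree_ex]. *)
Definition min_graph (R : realFieldType) (V : finType) (w : V -> V -> R)
    (P : pred (graph V)) : graph V :=
  odflt (set0, set0)
    [pick H | P H && [forall K, P K ==> (weight w H <= weight w K)]].

Definition steiner_subgraph (V : finType) (A : {set V}) : pred (graph V) :=
  fun H => [&& subgraph H, connected H & A \subset H.1].

Definition steiner_tree (R : realFieldType) (V : finType) (w : V -> V -> R)
    (A : {set V}) : graph V :=
  min_graph w (steiner_subgraph A).

Definition spanning_tree (V : finType) : pred (graph V) :=
  fun H => [&& subgraph H, H.1 == setT, connected H & acyclic H.2].

Definition mst_weight (R : realFieldType) (V : finType) (w : V -> V -> R) : R :=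
  weight w (min_graph w (@spanning_tree V)).

Fixpoint walk_weight (R : realFieldType) (T : Type) (l : T -> T -> R)
    (x : T) (p : seq T) : R :=
  if p is y :: p' then l x y + walk_weight l y p' else 0.

Definition shortest_path_metric (R : realFieldType) (T : eqType) (e : rel T)
    (l : T -> T -> R) (d : T -> T -> R) : Prop :=
  forall x y,
    (exists p, [/\ path e x p, last x p = y & d x y = walk_weight l x p]) /\
    (forall p, path e x p -> last x p = y -> d x y <= walk_weight l x p).

(* The star with leaf set V has vertex type [option V], with center [None]. *)
Definition star_edge (V : finType) : rel (option V) :=
  [rel x y | (x == None) != (y == None)].

Definition star_length (R : realFieldType) (V : finType) (wt : V -> R)
    (x y : option V) : R :=
  match x, y with
  | None, Some u | Some u, None => wt u
  | _, _ => 0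
  end.

(* Zero edge weights are allowed, so S may be only a semimetric. *)
Definition star_metric (R : realFieldType) (V : finType) (wt : V -> R)
    (S : option V -> option V -> R) : Prop :=
  (forall u, 0 <= wt u) /\
  shortest_path_metric (@star_edge V) (star_length wt) S.

Lemma edge_weight2 (R : realFieldType) (V : finType) (w : V -> V -> R) (x y : V) :
  is_metric w -> x != y -> edge_weight w [set x; y] = w x y.
Proof.
move=> [_ w0 wC _] nxy; rewrite /edge_weight.
have wxx z : w z z = 0 by apply/w0.
rewrite !big_setU1 ?inE //= !big_set1 !big_setU1 ?inE //= !big_set1 !wxx.
by rewrite addr0 add0r (wC y x) -mulr2n -(mulr_natr (w x y)) mulfK ?pnatr_eq0.
Qed.

Lemma min_graphP (R : realFieldType) (V : finType) (w : V -> V -> R)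
    (P : pred (graph V)) (H0 : graph V) :
  P H0 -> P (min_graph w P) /\
          forall K, P K -> weight w (min_graph w P) <= weight w K.
Proof.
move=> PH0; rewrite /min_graph; case: pickP => /= [H /andP[PH /forallP minH]|].
  by split=> // K; apply/implyP/minH.
have [H PH minH] := Order.TotalTheory.arg_minP (weight w) PH0.
move/(_ H); rewrite PH /= => /negbT/forallPn[K].
by rewrite negb_imply => /andP[PK]; rewrite minH.
Qed.

Lemma steiner_subgraph_ex (V : finType) (A : {set V}) :
  steiner_subgraph A (setT, [set e : {set V} | #|e| == 2%N]).
Proof.
apply/and3P; split; rewrite ?subsetT //.
  by apply/forall_inP => e; rewrite inE subsetT andbT.
apply/forall_inP => x _; apply/forall_inP => y _.
have [->//|nxy] := eqVneq x y.
by apply: connect1; rewrite /adj /= inE cards2 nxy.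
Qed.

Lemma spanning_tree_ex (V : finType) (v0 : V) :
  spanning_tree (setT, [set [set v0; u] | u in [set~ v0]]).
Proof.
set E := imset _ _.
have adj0 u : adj E v0 u = (u != v0).
  apply/imsetP/idP => [[v vv0 eq_uv]|uv0]; last by exists u; rewrite ?inE.
  have: v \in [set v0; u] by rewrite eq_uv !inE eqxx orbT.
  by rewrite !inE in vv0 *; rewrite (negPf vv0) /= => /eqP <-.
have adjC : symmetric (adj E) by move=> x y; rewrite /adj /= setUC.
have adjE x y : adj E x y -> (x == v0) || (y == v0).
  case/imsetP => v _ eq_xy; have: v0 \in [set x; y] by rewrite eq_xy !inE eqxx.
  by rewrite !inE ![v0 == _]eq_sym.
apply/and4P; split=> //.
- apply/forall_inP => e /imsetP[u]; rewrite !inE subsetT andbT => nu0 ->.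
  by rewrite cards2 (eq_sym v0) nu0.
- have c0 x : connect (adj E) v0 x.
    by have [->//|nx] := eqVneq x v0; apply: connect1; rewrite adj0.
  apply/forall_inP => x _; apply/forall_inP => y _.
  by apply: connect_trans (c0 y); rewrite (sym_connect_sym adjC) ?c0.
apply/forallP => n; apply/forallP => c; apply/implyP => /andP[].
rewrite -[n in (n <= 2)%N](size_tuple c); case: (tval c) => [|x [|y [|z s]]] //=.
case/and3P=> /adjE exy /adjE eyz ps /and3P[]; rewrite !inE !negb_or.
case/and3P=> nxy nxz xs /andP[nyz ys] /andP[zs _].
have yv0 : y = v0.
  apply/eqP; apply/negPn/negP => ny.
  move: exy eyz; rewrite (negPf ny) orbF /= => /eqP xv /eqP zv.
  by rewrite xv zv eqxx in nxz.
move: nxy nyz ys; rewrite yv0 => nx nz; rewrite eq_sym in nz.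
case: s ps xs zs => [|t s] /=.
  by rewrite andbT => /adjE; rewrite (negPf nz) (negPf nx).
by case/andP=> /adjE; rewrite (negPf nz) /= => /eqP -> _ _ _; rewrite inE eqxx.
Qed.

(* Main.v *)
Require Import Defs.
From mathcomp Require Import all_boot all_order all_algebra.
Set Implicit Arguments.
Unset Strict Implicit.
Unset Printing Implicit Defensive.
Import Order.TTheory GRing.Theory Num.Theory.
Local Open Scope ring_scope.

(** Root a minimum spanning tree at [v0] and give every leaf [u != v0] the
    weight of the tree edge from [u] to its parent ([v0] gets weight 0).  Let K
    be a Steiner tree of V' with vertex set U.  Deleting from the spanning tree
    the parent edges of the vertices of U leaves components that contain exactly
    one vertex of U each, so adding K reconnects everything; by minimality of
    the spanning tree K weighs at least the deleted edges. *)

(** The metric in closed form: [oapp wt 0] is the distance to the center. Equal points are set apart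
    because going from a leaf to the center and back costs [2 * wt u]. *)
Definition star_dist (R : realFieldType) (V : finType) (wt : V -> R)
    (x y : option V) : R :=
  if x == y then 0 else oapp wt 0 x + oapp wt 0 y.

Lemma star_metric_dist (R : realFieldType) (V : finType) (wt : V -> R) :
  (forall u, 0 <= wt u) -> star_metric wt (star_dist wt).
Proof.
move=> wt0; split=> // x y; split; last first.
  have o0 z : 0 <= oapp wt 0 z by case: z => /=.
  move=> p; elim: p x => [x _ /= ->|z p IHp x /= /andP[exz pzp] lzp].
    by rewrite /star_dist eqxx.
  (* What remains is the triangle inequality across the first edge of the walk. *)
  apply: le_trans (lerD (lexx _) (IHp z pzp lzp)).
  have -> : star_length wt x z = oapp wt 0 x + oapp wt 0 z.
    by case: x z exz {pzp lzp} => [u|] [v|] //= _; rewrite ?addr0 ?add0r.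
  rewrite /star_dist; case: (eqVneq x y) => [_|nxy].
    by case: ifP => _; rewrite !addr_ge0.
  case: (eqVneq z y) => [->|_]; first by rewrite addr0.
  by rewrite -addrA lerD2l addrA lerDr addr_ge0.
rewrite /star_dist; case: eqVneq => [->|]; first by exists [::].
case: x y => [u|] [v|] //= _.
- by exists [:: None; Some v]; rewrite /= addr0.
- by exists [:: None]; rewrite /= addr0.
- by exists [:: Some v]; rewrite /= addr0 add0r.
Qed.

Lemma edge_weight_ge0 (R : realFieldType) (V : finType) (w : V -> V -> R) e :
  is_metric w -> 0 <= edge_weight w e.
Proof.
by case=> w0 _ _ _; rewrite divr_ge0 // sumr_ge0 // => x _; rewrite sumr_ge0.
Qed.

Lemma weightU_le (R : realFieldType) (V : finType) (w : V -> V -> R)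
    (A B : {set V}) (E F : {set {set V}}) :
  is_metric w -> weight w (A, E :|: F) <= weight w (A, E) + weight w (B, F).
Proof.
move=> wm; rewrite /weight /= big_mkcond [X in _ <= X + _]big_mkcond.
rewrite [X in _ <= _ + X]big_mkcond -big_split ler_sum //= => e _.
have := edge_weight_ge0 e wm; rewrite inE.
by case: (e \in E); case: (e \in F) => /= e0; rewrite ?addr0 ?add0r // lerDl.
Qed.

Lemma weightS (R : realFieldType) (V : finType) (w : V -> V -> R)
    (A B : {set V}) (E F : {set {set V}}) :
  is_metric w -> E \subset F -> weight w (A, E) <= weight w (B, F).
Proof.
move=> wm sEF; rewrite /weight /= [leRHS](big_setID E) /= (setIidPr sEF).
by rewrite lerDl sumr_ge0 // => e _; apply: edge_weight_ge0.
Qed.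

Lemma adj_sym (V : finType) (E : {set {set V}}) : symmetric (adj E).
Proof. by move=> x y; rewrite /adj /= setUC. Qed.

Lemma connected_from (V : finType) (v0 : V) (H : graph V) :
  (forall u, u \in H.1 -> connect (adj H.2) u v0) -> connected H.
Proof.
move=> c0; apply/forall_inP => x Hx; apply/forall_inP => y Hy.
apply: connect_trans (c0 x Hx) _.
by rewrite (sym_connect_sym (@adj_sym _ _)) c0.
Qed.

(* The witness for [d] is the distance to [v0] in number of edges. *)
Lemma connected_parent (V : finType) (e : rel V) (v0 : V) :
  symmetric e -> (forall u, connect e v0 u) ->
  exists (par : V -> V) (d : V -> nat),
    forall u, u != v0 -> e u (par u) && (d (par u) < d u)%N.
Proof.
move=> e_sym c0.
pose P u n := [exists t : n.-tuple V, path e v0 t && (last v0 t == u)].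
have exP u : exists n, P u n.
  have [p ep ->] := connectP (c0 u).
  by exists (size p); apply/existsP; exists (in_tuple p); rewrite ep eqxx.
pose d u := ex_minn (exP u).
pose par u := odflt u [pick y | e u y && (d y < d u)%N].
exists par, d => u nu0; rewrite /par; case: pickP => //= none.
have: P u (d u) by rewrite /d; case: ex_minnP.
(* The last vertex but one of a shortest path from [v0] to [u] is adjacent to [u] and closer to
   [v0], which contradicts [none]; so the default [u] of [par] is never returned away from [v0]. *)
case/existsP=> -[t /= /eqP]; case/lastP: t => [_|q z].
  by move=> /= /eqP eq0; rewrite eq0 eqxx in nu0.
rewrite size_rcons rcons_path last_rcons => sz /andP[/andP[eq elz] /eqP eqz].
have := none (last v0 q); rewrite e_sym -eqz elz /= eqz -sz ltnS.
rewrite /d; case: ex_minnP => m _ minm; rewrite minm //.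
by apply/existsP; exists (in_tuple q); rewrite eq eqxx.
Qed.

(** Used only for [D] avoiding the root, where [par] is arbitrary. *)
Definition parent_edges (V : finType) (par : V -> V) (D : {set V}) :=
  [set [set u; par u] | u in D].

Section ParentMap.

Context (V : finType) (v0 : V) (par : V -> V) (d : V -> nat).
Hypothesis par_lt : forall u, u != v0 -> (d (par u) < d u)%N.

Lemma parent_neq u : u != v0 -> u != par u.
Proof. by move/par_lt; apply: contraTneq => <-; rewrite ltnn. Qed.

(** Distinct vertices with the same parent edge would be parents of each other, so each would be
    strictly deeper than the other. *)
Lemma parent_edge_inj : {in [set~ v0] &, injective (fun u => [set u; par u])}.
Proof.
move=> u v; rewrite !inE => /par_lt du /par_lt dv eq_uv.
have: u \in [set v; par v] by rewrite -eq_uv !inE eqxx.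
have: v \in [set u; par u] by rewrite eq_uv !inE eqxx.
rewrite !inE => /orP[/eqP->//|/eqP vu] /orP[/eqP->//|/eqP uv].
by move: du dv; rewrite -vu -uv => /ltnW; rewrite leqNgt => /negPf ->.
Qed.

Lemma weight_parent_edges (R : realFieldType) (w : V -> V -> R) (A D : {set V}) :
  is_metric w -> D \subset [set~ v0] ->
  weight w (A, parent_edges par D) = \sum_(u in D) w u (par u).
Proof.
move=> wm /subsetP sD; rewrite /weight big_imset /=; last first.
  by move=> u v /sD Du /sD Dv; apply: parent_edge_inj.
apply: eq_bigr => u /sD; rewrite !inE => nu0.
by rewrite edge_weight2 ?parent_neq.
Qed.

(** Climbing from parent to parent out of a vertex not in [K] must meet [K], at [v0] at the latest;
    inside [K] one then walks to [v0]. *)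
Lemma steiner_graft (K : graph V) :
  subgraph K -> connected K -> v0 \in K.1 ->
  steiner_subgraph setT (setT, K.2 :|: parent_edges par (~: K.1)).
Proof.
move=> /forall_inP sK /forall_inP cK K0.
apply/and3P; split; rewrite ?subsetT //.
  apply/forall_inP => e; rewrite !inE subsetT andbT => /orP[/sK/andP[]//|].
  case/imsetP=> u; rewrite inE => Ku ->; rewrite cards2 parent_neq //.
  by apply: contraNneq Ku => ->.
apply: (@connected_from _ v0) => /= u _.
have [n] := ubnP (d u); elim: n u => // n IHn u; rewrite ltnS => du.
have [Ku|Ku] := boolP (u \in K.1).
  apply: connect_sub (forall_inP (cK u Ku) v0 K0) => x y Exy.
  by apply: connect1; rewrite /adj /= inE [_ \in _]Exy.
have nu0 : u != v0 by apply: contraNneq Ku => ->.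
apply: connect_trans (IHn _ (leq_trans (par_lt nu0) du)).
by apply: connect1; apply/setUP; right; apply/imsetP; exists u; rewrite ?inE.
Qed.

(* A vertex of maximal depth on a cycle is adjacent to no vertex of the cycle
   except its parent, so its two neighbours on the cycle coincide. *)
Lemma acyclic_parent_edges : acyclic (parent_edges par [set~ v0]).
Proof.
set E := parent_edges _ _.
have adj_par x y : adj E x y -> (d y <= d x)%N -> y = par x.
  case/imsetP=> u; rewrite !inE => nu0 eq_xy dyx.
  have: x \in [set u; par u] by rewrite -eq_xy !inE eqxx.
  have: u \in [set x; y] by rewrite eq_xy !inE eqxx.
  have: par u \in [set x; y] by rewrite eq_xy !inE eqxx orbT.
  rewrite !inE; have [->|_] := eqVneq x u.
    by rewrite eq_sym (negPf (parent_neq nu0)) => /eqP.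
  move=> _ /eqP eq_uy /eqP eq_xp.
  by move: dyx; rewrite -eq_uy eq_xp leqNgt par_lt.
apply/forallP => n; apply/forallP => c; apply/implyP => /andP[cyc Uc].
rewrite leqNgt -[n in (2 < n)%N](size_tuple c); apply/negP => sz.
have [x cx maxx] : exists2 x, x \in (c : seq V)
    & forall y, y \in (c : seq V) -> (d y <= d x)%N.
  have: has predT c by rewrite has_predT; case: (tval c) sz.
  case/hasP=> z cz _; case: (arg_maxnP d cz) => x cx maxx.
  by exists x.
(* Rotate the cycle to start at its deepest vertex [x]. Its second entry [y] and last entry [z] are
   then both [par x], against uniqueness. *)
have [i s rot_c] := rot_to cx.
have memc : c =i x :: s by move=> z; rewrite -rot_c mem_rot.
move: cyc Uc sz; rewrite -(rot_cycle i) -(rot_uniq i) -(size_rot i) rot_c.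
case/lastP: s memc {rot_c} => [//|s z] memc; case: s memc => [//|y s] memc.
rewrite /= rcons_path last_rcons => /andP[exy /andP[_ ezx]] /and3P[_ ys _] _.
have cy : y \in (c : seq V) by rewrite memc !inE eqxx orbT.
have cz : z \in (c : seq V) by rewrite memc !inE mem_rcons !inE eqxx !orbT.
move: ys; rewrite (adj_par _ _ exy (maxx y cy)) mem_rcons inE.
by rewrite adj_sym in ezx; rewrite (adj_par _ _ ezx (maxx z cz)) eqxx.
Qed.

Lemma parent_spanning_tree :
  spanning_tree (setT, parent_edges par [set~ v0]).
Proof.
(* Connectedness comes from grafting all parent edges onto the one-vertex graph at [v0]. *)
have s0 : subgraph ([set v0], set0) by apply/forall_inP => e; rewrite inE.
have c0 : connected ([set v0], set0).
  by apply: (@connected_from _ v0) => u; rewrite inE => /eqP ->.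
have := steiner_graft s0 c0 (set11 v0); rewrite /= set0U.
case/and3P=> sT cT _; apply/and4P; split=> //.
exact: acyclic_parent_edges.
Qed.

End ParentMap.

Theorem theorem1 (R : realFieldType) (V : finType) (w : V -> V -> R)
    (w_metric : is_metric w) (v0 : V) :
  exists (S : option V -> option V -> R) (wt : V -> R),
    [/\ star_metric wt S,
        forall u : V, wt u = S None (Some u),
        \sum_(u : V) wt u = weight w (steiner_tree w [set: V]),
        weight w (steiner_tree w [set: V]) = mst_weight w
      & forall V' : {set V}, v0 \in V' ->
          weight w (steiner_tree w V') >= \sum_(u in V') wt u].
Proof.
have [/and3P[sT cT vT] minT] := min_graphP w (steiner_subgraph_ex [set: V]).
have [tM minM] := min_graphP w (spanning_tree_ex v0).
rewrite -/(steiner_tree w [set: V]) in sT cT vT minT.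
set T := steiner_tree w [set: V] in sT cT vT minT *.
have c0 u : connect (adj T.2) v0 u.
  have inT x : x \in T.1 by apply: (subsetP vT); rewrite inE.
  exact: (forall_inP (forall_inP cT v0 (inT _))) (inT u).
have [par [d parP]] := connected_parent (@adj_sym _ _) c0.
have par_lt u : u != v0 -> (d (par u) < d u)%N by case/parP/andP.
pose wt u := if u == v0 then 0 else w u (par u).
have wt0 u : 0 <= wt u by rewrite /wt; case: ifP => // _; case: w_metric.
have wtE (D : {set V}) A : D \subset [set~ v0] ->
    weight w (A, parent_edges par D) = \sum_(u in D) wt u.
  move=> sD; rewrite (weight_parent_edges par_lt) //.
  apply: eq_bigr => u /(subsetP sD); rewrite !inE /wt => /negPf -> //.
(* [T] is known to be a lightest connected graph on [V], not a tree. The tree [P] uses only edges of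
   [T], so minimality of [T] makes the two weights equal. *)
pose P : graph V := ([set: V], parent_edges par [set~ v0]).
have tP : spanning_tree P := parent_spanning_tree par_lt.
have span_steiner H : spanning_tree H -> steiner_subgraph setT H.
  by case/and4P=> sH /eqP vH cH _; rewrite /steiner_subgraph sH cH vH subsetT.
have leTP : weight w T <= weight w P by apply: minT; apply: span_steiner.
have lePT : weight w P <= weight w T.
  rewrite [T in leRHS]surjective_pairing; apply: weightS => //.
  by apply/subsetP => _ /imsetP[u nu0 ->]; rewrite !inE in nu0; case/parP/andP: nu0.
have wP : weight w P = weight w T by apply/le_anti/andP.
have sumP : \sum_u wt u = weight w P.
  rewrite wtE // (bigD1 v0) //= {1}/wt eqxx add0r.
  by apply: eq_bigl => u; rewrite !inE.
exists (star_dist wt), wt; split.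
- exact: star_metric_dist.
- by move=> u; rewrite /star_dist /= add0r.
- by rewrite sumP.
- rewrite /mst_weight; apply/le_anti/andP; split.
    by apply: minT; apply: span_steiner.
  by rewrite -wP; apply: minM.
move=> A A0.
have [/and3P[]] := min_graphP w (steiner_subgraph_ex A).
rewrite -/(steiner_tree w A); set K := steiner_tree w A => sK cK vK _.
have K0 : v0 \in K.1 := subsetP vK v0 A0.
(* The exchange: [K] with the parent edges of the vertices outside it competes with [T]. *)
have leT := minT _ (steiner_graft par_lt sK cK K0).
have := le_trans leT (weightU_le setT (~: K.1) _ _ w_metric).
rewrite wtE; last by rewrite setCS sub1set.
(* Splitting the total along [K.1], the part outside cancels against the grafted edges and leaves
   the sum of [wt] over [K.1] bounded by the weight of [K]. *)
rewrite -wP -sumP (bigID (mem K.1)) /= [X in _ + X <= _](eq_bigl (mem (~: K.1))); last first.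
  by move=> u; rewrite !inE.
rewrite lerD2r => leK; apply: le_trans leK.
(* Steiner vertices of [K] outside [A] only add nonnegative terms. *)
by rewrite [leRHS](big_setID A) /= (setIidPr vK) lerDl sumr_ge0.
Qed.
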